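(* Let $\{X_n\}_{n=1}^\infty$ be nonnegative, bounded, i.i.d., non-degenerate random variables, and let $\gamma(H^2_\mu)=\liminf_{n\to\infty}\sqrt[n]{w_n}$ be the convergence radius of the associated random Hardy space $H^2_\mu$. Then $\gamma(H^2_\mu)=e^{\mathbb E(\ln X_1)}$ almost surely.
   Context: For the i.i.d. sequence $\{X_n\}$ on a probability space $(\Omega,\mathcal F,\mathbb P)$ put $w_0=1$, $w_n=X_1\cdots X_n$ ($n\ge1$). For each $\omega$, the random Hardy space is $H^2_\mu(\omega)=\{f(z)=\sum_{n\ge0}a_nz^n:\ \sum_{n\ge0}|a_n|^2w_n(\omega)^2<\infty\}$, where $\mu$ is the law of $X_1$. $X_1$ is non-degenerate if its essential range (closed support of its law) contains more than one point. $\mathbb E(\ln X_1)\in[-\infty,\infty)$ with $\ln 0=-\infty$, $e^{-\infty}=0$. *)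

(* Defs.v *)
From mathcomp Require Import all_boot all_order all_algebra finmap.
From mathcomp Require Import all_classical all_reals all_analysis.
Set Implicit Arguments.
Unset Strict Implicit.
Unset Printing Implicit Defensive.
Import Order.TTheory GRing.Theory Num.Theory.
Import numFieldNormedType.Exports.
Local Open Scope classical_set_scope.
Local Open Scope ring_scope.

Section iid.
Context (d : measure_display) (T : measurableType d) (R : realType).
Variable P : probability T R.

Definition mutually_independent (X : nat -> {RV P >-> R}) : Prop :=
  forall (J : {fset nat}) (A : nat -> set R),
    (forall i, i \in J -> measurable (A i)) ->
    P (\bigcap_(i in [set` J]) (X i @^-1` A i)) =
    (\prod_(i <- J) P (X i @^-1` A i))%E.

Definition identically_distributed (X : nat -> {RV P >-> R}) : Prop :=
  forall (i j : nat) (A : set R), measurable A ->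
    distribution P (X i) A = distribution P (X j) A.

Definition iid (X : nat -> {RV P >-> R}) : Prop :=
  mutually_independent X /\ identically_distributed X.

Definition nonneg_rv (Y : {RV P >-> R}) : Prop := \forall x \ae P, 0 <= Y x.

Definition bounded_rv (Y : {RV P >-> R}) : Prop :=
  exists M : R, \forall x \ae P, `|Y x| <= M.

(* The essential range of Y is the closed support of its law. *)
Definition essential_range (Y : {RV P >-> R}) : set R :=
  [set a | forall U : set R, open U -> U a -> (0 < distribution P Y U)%E].

Definition nondegenerate_rv (Y : {RV P >-> R}) : Prop :=
  exists a b : R, [/\ essential_range Y a, essential_range Y b & a != b].

(* E(ln Y) in the extended reals: [lne] takes the value -oo at 0, whereas the
   real-valued [ln] takes the junk value 0 there. *)
Definition expected_ln (Y : {RV P >-> R}) : \bar R :=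
  (\int[P]_x lne (Y x)%:E)%E.

(* Sequences are indexed from 0: [X i] is the variable X_(i+1) of the usual
   1-based indexing, so that w_n = X_1 ... X_n and w_0 = 1. *)
Definition hardy_weight (X : nat -> {RV P >-> R}) (n : nat) (x : T) : R :=
  \prod_(i < n) X i x.

End iid.

(* Convergence radius liminf_n (w_n)^(1/n) of the weighted Hardy space of the
   power series sum_n a_n z^n with sum_n |a_n|^2 w_n^2 < oo.  The term n = 0 is
   immaterial; [powR] gives 0 `^ n^-1 = 0 for n > 0. *)
Definition hardy_radius (R : realType) (w : nat -> R) : \bar R :=
  limn_einf (fun n : nat => (powR (w n) n%:R^-1)%:E).

(* Main.v *)
From HB Require Import structures.
Require Import Defs.
From mathcomp Require Import all_boot all_order all_algebra finmap.
From mathcomp Require Import all_classical all_reals all_analysis.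
From mathcomp Require Import measurable_realfun.
Set Implicit Arguments.
Unset Strict Implicit.
Unset Printing Implicit Defensive.
Import Order.TTheory GRing.Theory Num.Theory.
Import numFieldNormedType.Exports.
Local Open Scope classical_set_scope.
Local Open Scope ring_scope.

(** Taking logarithms, ln (w_n) / n is the average of n copies of ln X_1, and
    the claim is the strong law of large numbers for variables that are bounded
    above and may have mean -oo.  The radius is a liminf of e to these averages,
    so it suffices to have, for each real a, a one-sided comparison of w_n with
    e^(n a): w_n = O(e^(n a)) almost surely if a > E(ln X_1), which bounds the
    radius by e^a ([hardy_radius_le_expR]), and e^(n a) = O(w_n) almost surely
    if a < E(ln X_1) ([expR_le_hardy_radius]).  Letting a tend to E(ln X_1)
    through a countable set gives the theorem; if E(ln X_1) = -oo only the upper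
    bounds are needed, the radius being nonnegative.

    Both comparisons say that a random walk with i.i.d. integrable steps of
    negative mean is almost surely bounded above ([negative_drift_bounded]): its
    steps are ln (max X_i e) - a with e > 0 small in the first case, a - ln X_i
    in the second.

    This boundedness has a short proof on the space of sequences, equipped with
    the law of the i.i.d. sequence and the shift.  The law is shift invariant,
    and the event that the walk is unbounded above is an invariant event.  The
    maximal ergodic lemma ([maximal_ergodic]) says that the first step has
    nonnegative integral over this event.  Being invariant, the event depends
    only on the variables after the first, so it is independent of the first
    step ([coord_shift_indep]), and that integral is also its probability times
    the mean of a step.  As the mean is negative, the probability is 0. *)

(** * A maximal ergodic lemma *)

Section maximal.
Context d (T : measurableType d) (R : realType) (P : {measure set T -> \bar R}).
Variable theta : {mfun T >-> T}.
Hypothesis theta_pres : forall A, measurable A -> P (theta @^-1` A) = P A.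
Variable f : T -> R.
Hypothesis mf : measurable_fun setT f.

(** The running maximum of the partial sums 0, f x, f x + f (theta x), ... with
    at most [n] terms.  Splitting off the first term makes it a recursion on
    the shifted orbit, which is what lets stationarity be used. *)
Fixpoint maxsum n x : R :=
  if n is m.+1 then Num.max 0 (f x + maxsum m (theta x)) else 0.

Definition unbounded_sums : set T :=
  [set x | forall k, exists n, k%:R <= maxsum n x].

Lemma maxsum_ge0 n x : 0 <= maxsum n x.
Proof. by case: n => //= n; rewrite le_max lexx. Qed.

Lemma maxsum_nondecreasing x : {homo maxsum^~ x : m n / (m <= n)%N >-> m <= n}.
Proof.
apply: homo_leq => [//|? ? ?|n]; first exact: le_trans.
elim: n x => [|n IHn] x; first exact: maxsum_ge0.
by rewrite /= ge_max le_max lexx /= le_max lerD2l IHn orbT.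
Qed.

Lemma sum_le_maxsum n x : \sum_(i < n) f (iter i theta x) <= maxsum n x.
Proof.
elim: n x => [|n IHn] x; first by rewrite big_ord0.
rewrite big_ord_recl /= le_max lerD2l (le_trans _ (IHn _)) ?orbT//.
rewrite le_eqVlt; apply/orP; left; apply/eqP/eq_bigr => i _.
by rewrite -iterS iterSr.
Qed.

Lemma measurable_maxsum n : measurable_fun setT (maxsum n).
Proof.
elim: n => [|n IHn]; first exact: measurable_cst.
apply: measurable_maxr => //; apply: measurable_funD => //.
exact: measurableT_comp.
Qed.

Lemma measurable_unbounded : measurable unbounded_sums.
Proof.
rewrite (_ : unbounded_sums =
    \bigcap_k \bigcup_n (maxsum n @^-1` [set r | k%:R <= r])); last first.
  apply/seteqP; split=> x /= h k; first by move=> _; have [n ?] := h k; exists n.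
  by have [n _ ?] := h k Logic.I; exists n.
apply: bigcapT_measurable => k; apply: bigcupT_measurable => n.
rewrite -[X in measurable X]setTI; apply: measurable_maxsum => //.
rewrite (_ : mkset _ = `[k%:R, +oo[%classic); first exact: measurable_itv.
by apply/seteqP; split=> r /=; rewrite in_itv/= andbT.
Qed.

(** Dropping the first term changes every partial sum by the same finite
    amount [f x], so it does not affect unboundedness. *)
Lemma unbounded_invariant : theta @^-1` unbounded_sums = unbounded_sums.
Proof.
apply/seteqP; split=> x /= h k.
  have [n hn] := h (Num.truncn (k%:R - f x)).+1.
  exists n.+1; rewrite /= le_max -lerBlDl (le_trans _ hn) ?orbT//.
  exact/ltW/truncnS_gt.
(* A positive bound rules out the empty sum as a witness, and makes the
   maximum with 0 equal to its other argument. *)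
have [[|n] /=] := h (maxn 1 (Num.truncn (k%:R + f x)).+1).
  by rewrite lern0 -leqn0 geq_max.
move=> hn; exists n.
have : k%:R + f x <= Num.max 0 (f x + maxsum n (theta x)).
  apply: le_trans hn; apply/ltW/(lt_le_trans (truncnS_gt _)).
  by rewrite ler_nat leq_maxr.
have : 0 < Num.max 0 (f x + maxsum n (theta x)).
  by apply: lt_le_trans hn; rewrite ltr0n leq_max.
by rewrite lt_max ltxx /= => h0; rewrite max_r ?(ltW h0)// addrC lerD2l.
Qed.

Local Open Scope ereal_scope.

Lemma ge0_integral_invariant (B : set T) (g : T -> \bar R) : measurable B ->
  theta @^-1` B = B -> measurable_fun setT g -> (forall x, 0 <= g x) ->
  \int[P]_(x in B) g (theta x) = \int[P]_(x in B) g x.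
Proof.
move=> mB BE mg g0; rewrite -[in LHS]BE.
rewrite -[LHS](ge0_integral_pushforward (phi := theta))//; last first.
  exact: measurable_funTS.
by apply: eq_measure_integral => A mA _; exact: theta_pres.
Qed.

Hypothesis intf : P.-integrable setT (EFin \o f).

Lemma integrable_maxsum n : P.-integrable setT (EFin \o maxsum n).
Proof.
elim: n => [|n IHn]; first exact: integrable0.
have IHn' : P.-integrable setT (EFin \o (maxsum n \o theta)).
  apply/integrableP; split.
    by apply/measurable_EFinP/measurableT_comp => //; exact: measurable_maxsum.
  rewrite (@ge0_integral_invariant setT (fun x => `|(maxsum n x)%:E|))//.
    by have /integrableP[] := IHn.
  by apply: measurableT_comp => //; apply/measurable_EFinP/measurable_maxsum.
apply: le_integrable (integrableD measurableT intf IHn') => //.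
  exact/measurable_EFinP/measurable_maxsum.
move=> x _ /=; rewrite lee_fin maxEle.
by case: ifPn => // _; rewrite normr0.
Qed.

(** With M_n = [maxsum n], the increment h_n = M_(n+1) - M_n o theta equals
    max (- M_n o theta, f).  It dominates M_n - M_n o theta, whose integral over
    the invariant event vanishes, so h_n has nonnegative integral there.  On
    that event M_n o theta tends to infinity, hence h_n is eventually equal to
    f; as |h_n| <= |f|, dominated convergence passes to the limit. *)
Lemma maximal_ergodic : 0 <= \int[P]_(x in unbounded_sums) (f x)%:E.
Proof.
set B := unbounded_sums.
have mB : measurable B := measurable_unbounded.
pose h n x : R := (maxsum n.+1 x - maxsum n (theta x))%R.
have mM n : measurable_fun setT (maxsum n) := measurable_maxsum n.
have mMt n : measurable_fun setT (maxsum n \o theta) by exact: measurableT_comp.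
have intM n : P.-integrable B (EFin \o maxsum n).
  by apply: integrableS (integrable_maxsum n).
have intMt n : P.-integrable B (EFin \o (maxsum n \o theta)).
  apply: (@integrableS _ _ _ _ setT) => //.
  apply/integrableP; split; first exact/measurable_EFinP.
  rewrite (@ge0_integral_invariant setT (fun x => `|(maxsum n x)%:E|))//.
    by have /integrableP[] := integrable_maxsum n.
  by apply: measurableT_comp => //; exact/measurable_EFinP.
have hE n x : h n x = Num.max (- maxsum n (theta x))%R (f x).
  by rewrite /h /= addr_maxl add0r addrK.
have h_ge0 n : 0 <= \int[P]_(x in B) (h n x)%:E.
  rewrite /h integralB_EFin//; last exact: intMt.
  rewrite (@ge0_integral_invariant B (fun x => (maxsum n x)%:E))//.
  - rewrite sube_ge0 ?(integrable_fin_num mB (intM n)) ?orbT//.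
    apply: (le_integral mB (intM n) (intM n.+1)) => x _.
    by rewrite lee_fin maxsum_nondecreasing.
  - exact: unbounded_invariant.
  - exact/measurable_EFinP.
  - by move=> x; rewrite lee_fin maxsum_ge0.
have h_cvg x : B x -> (fun n => (EFin \o h n) x) @ \oo --> (f x)%:E.
  move=> Bx; have : (theta @^-1` B) x by rewrite /B unbounded_invariant.
  move=> /(_ (Num.truncn (- f x)).+1)[m hm].
  apply: cvg_near_cst; exists m => // j /= mj; rewrite hE max_r// lerNl.
  rewrite (le_trans (ltW (truncnS_gt _)))// (le_trans hm)//.
  exact: maxsum_nondecreasing.
have mh n : measurable_fun B (EFin \o h n).
  by apply/measurable_EFinP/measurable_funTS/measurable_funB;
    [exact: (mM n.+1)|exact: mMt].
have mfB : measurable_fun B (EFin \o f).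
  exact/measurable_EFinP/measurable_funTS.
have intnf : P.-integrable B (EFin \o (fun x => `|f x|%R)).
  by apply: (@integrableS _ _ _ _ setT) => //; exact: integrable_norm.
have h_dom x n : B x -> `|(EFin \o h n) x| <= (EFin \o (fun x => `|f x|%R)) x.
  move=> _; rewrite /= lee_fin hE ler_norml; apply/andP; split.
    by rewrite le_max orbC lerNl -normrN ler_norm.
  rewrite ge_max ler_norm andbT (le_trans _ (normr_ge0 _))//.
  by rewrite oppr_le0 maxsum_ge0.
have [_ _ hint] := @dominated_convergence _ _ _ P B mB (fun n => EFin \o h n)
  (EFin \o f) (EFin \o (fun x => `|f x|%R)) mh mfB
  (aeW _ h_cvg) intnf (aeW _ h_dom).
rewrite -(cvg_lim _ hint)//; apply: lime_ge.
  by apply/cvg_ex; eexists; exact: hint.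
by apply: nearW => n; exact: h_ge0.
Qed.

End maximal.

(** * The space of real sequences and its shift *)

Section sequence_space.
Variable R : realType.

Definition cylinder (n : nat) (A : nat -> set R) : set (nat -> R) :=
  [set w | forall i, (i < n)%N -> A i (w i)].

(** A cylinder may constrain any number of leading coordinates, so that the
    cylinders form a pi-system. *)
Definition cylinders : set (set (nat -> R)) :=
  [set C | exists n A, (forall i, measurable (A i)) /\ C = cylinder n A].

Definition seqspace : Type := g_sigma_algebraType cylinders.
HB.instance Definition _ := Measurable.on seqspace.

Lemma cylinders_setI : setI_closed cylinders.
Proof.
move=> _ _ [n [A [mA ->]]] [m [B [mB ->]]].
exists (maxn n m), (fun i => (if (i < n)%N then A i else setT) `&`
                             (if (i < m)%N then B i else setT)).
split=> [i|]; first by apply: measurableI; case: ifP.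
apply/seteqP; split=> w /=.
  by move=> [hA hB] i _; split; case: ifP => // ?; [exact: hA|exact: hB].
move=> h; split=> i ilt.
  by have [] := h i (leq_trans ilt (leq_maxl _ _)); rewrite ilt.
by have [] := h i (leq_trans ilt (leq_maxr _ _)); rewrite ilt.
Qed.

Lemma cylinders_setT : cylinders setT.
Proof.
by exists 0%N, (fun=> setT); split => //; apply/seteqP; split.
Qed.

Lemma measurable_to_seqspace d (T : measurableType d) (F : T -> seqspace) :
  (forall i, measurable_fun setT (fun x => F x i)) -> measurable_fun setT F.
Proof.
move=> mF; apply: (@measurability _ _ T seqspace setT F cylinders) => //.
move=> _ [_ [n [A [mA ->]]] <-]; rewrite setTI.
rewrite (_ : _ @^-1` _ = \bigcap_(i in `I_n) ((fun x => F x i) @^-1` A i))//.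
apply: bigcap_measurableType => i _.
by rewrite -[X in measurable X]setTI; exact: mF.
Qed.

Definition coord (i : nat) (w : seqspace) : R := w i.

Lemma measurable_coord i : measurable_fun setT (coord i).
Proof.
move=> _ A mA; rewrite setTI; apply: sub_sigma_algebra.
exists i.+1, (fun j => if j == i then A else setT); split.
  by move=> j; case: ifP.
apply/seteqP; split=> w /= => [Aw j _|/(_ i (ltnSn _))]; last by rewrite eqxx.
by case: eqP => // ->.
Qed.

HB.instance Definition _ i :=
  isMeasurableFun.Build _ _ _ _ (coord i) (measurable_coord i).

Definition shift (w : seqspace) : seqspace := fun i => w i.+1.

Lemma measurable_shift : measurable_fun setT shift.
Proof. by apply: measurable_to_seqspace => i; exact: (measurable_coord i.+1). Qed.

HB.instance Definition _ :=
  isMeasurableFun.Build _ _ _ _ shift measurable_shift.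

Lemma iter_shift n w : coord 0 (iter n shift w) = w n.
Proof.
suff H k : iter n shift w k = w (k + n)%N by rewrite /coord H.
elim: n k => [|n IHn] k /=; first by rewrite addn0.
by rewrite /shift IHn addSnnS.
Qed.

End sequence_space.
Arguments coord {R}.
Arguments shift {R}.

(** * The law of an i.i.d. sequence *)

Section iid.
Context d (T : measurableType d) (R : realType) (P : probability T R).
Variable X : nat -> {RV P >-> R}.
Hypothesis X_iid : iid X.

Definition sample_path (x : T) : seqspace R := fun i => X i x.

Lemma measurable_sample_path : measurable_fun setT sample_path.
Proof. by apply: measurable_to_seqspace => i; exact: measurable_funP. Qed.

HB.instance Definition _ :=
  isMeasurableFun.Build _ _ _ _ sample_path measurable_sample_path.

Let Q := distribution P (sample_path : {mfun T >-> seqspace R}).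

Local Open Scope ereal_scope.

Lemma distribution_cylinder n A : (forall i, measurable (A i)) ->
  Q (cylinder n A) = \prod_(i < n) distribution P (X 0%N) (A i).
Proof.
move=> mA; have [indep ident] := X_iid.
have := indep [fset i in iota 0%N n]%fset A (fun i _ => mA i).
have iotaE : perm_eq [fset i in iota 0%N n]%fset (index_iota 0%N n).
  by apply: uniq_perm => [||i];
    rewrite ?fset_uniq ?iota_uniq// /index_iota subn0 !inE.
rewrite (perm_big _ iotaE) big_mkord /= => PE.
rewrite (_ : Q _ =
    P (\bigcap_(i in [set` [fset i in iota 0%N n]%fset]) (X i @^-1` A i))).
  by rewrite PE; apply: eq_bigr => i _; exact: ident.
congr (P _); apply/seteqP; split=> x /=.
  by move=> h i /=; rewrite !inE mem_iota => /andP[_]; exact: h.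
by move=> h i lt_in; apply: h; rewrite /= !inE mem_iota.
Qed.

(** The one consequence of independence and identical distribution that is
    needed: the first variable is independent of the tail, and the tail has the
    law of the whole sequence.  For a fixed [C] both sides are finite measures
    in [B] that agree on cylinders. *)
Lemma coord_shift_indep C B : measurable C -> measurable B ->
  Q (coord 0%N @^-1` C `&` shift @^-1` B) = distribution P (X 0%N) C * Q B.
Proof.
move=> mC mB.
have mC0 : measurable (coord 0%N @^-1` C : set (seqspace R)).
  by rewrite -[X in measurable X]setTI; exact: measurable_coord.
have PC0 : (0 <= fine (distribution P (X 0%N) C))%R by rewrite fine_ge0.
have PCE : (fine (distribution P (X 0%N) C))%:E = distribution P (X 0%N) C.
  by rewrite fineK// fin_num_measure.
(* As measures in B: m1 is the left-hand side, m2 the right-hand side. *)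
pose m1 := pushforward (mrestr Q mC0) shift.
pose m2 := mscale (NngNum PC0) Q.
suff : m1 B = m2 B by rewrite /m1 /m2 /pushforward /mrestr /mscale/= PCE setIC.
pose M1 := [the {measure set seqspace R -> \bar R} of m1].
pose M2 := [the {measure set seqspace R -> \bar R} of m2].
have coverT : \bigcup_(k in [set: nat]) [set: seqspace R] = setT.
  by apply: bigcup_const; exists 0%N.
have unique := @measure_unique _ R (seqspace R) (@cylinders R) (fun=> setT)
  erefl (@cylinders_setI R) (fun=> cylinders_setT R) coverT
  (M1 (@measurable_shift R)) M2.
apply: unique => //.
- move=> _ [n [A [mA ->]]].
  rewrite -[LHS]/(Q (shift @^-1` cylinder n A `&` coord 0%N @^-1` C)).
  rewrite -[RHS]/(_%:E * Q (cylinder n A)) PCE distribution_cylinder//.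
  pose A' i := if i is j.+1 then A j else C.
  rewrite (_ : _ `&` _ = cylinder n.+1 A').
    by rewrite distribution_cylinder ?big_ord_recl// => -[|i] /=.
  apply/seteqP; split=> w /=.
    by move=> [h h0] [|i] //=; exact: h.
  by move=> h; split=> [i|]; [exact: (h i.+1)|exact: (h 0%N)].
- move=> _; rewrite /m1 /= /pushforward /mrestr preimage_setT setTI.
  by rewrite (le_lt_trans (probability_le1 _ _)) ?ltry//.
Qed.

Lemma shift_preserves B : measurable B -> Q (shift @^-1` B) = Q B.
Proof.
move=> mB; have := coord_shift_indep (@measurableT _ R) mB.
by rewrite preimage_setT setTI probability_setT mul1e.
Qed.

Section invariant_event.
Variable B : set (seqspace R).
Hypothesis mB : measurable B.
Hypothesis BE : shift @^-1` B = B.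

(** An invariant event is its own shift, hence an event about the tail, and so
    it is independent of the first coordinate. *)
Lemma ge0_integral_coord_invariant (g : R -> \bar R) :
  measurable_fun setT g -> (forall r, 0 <= g r) ->
  \int[Q]_(w in B) g (coord 0%N w) = Q B * \int[P]_x g (X 0%N x).
Proof.
move=> mg g0.
have mgc : measurable_fun setT (g \o coord 0%N) by exact: measurableT_comp.
have QB0 : (0 <= fine (Q B))%R by rewrite fine_ge0.
transitivity (\int[mrestr Q mB]_w g (coord 0%N w)).
  rewrite [RHS](ge0_negligible_integral (N := ~` B))//=; first last.
  - by rewrite /mrestr setICl measure0.
  - exact: measurableC.
  rewrite setTD setCK; apply: eq_measure_integral => A mA AB.
  by rewrite -[RHS]/(Q (A `&` B)) setIidl.
transitivity (\int[pushforward (mrestr Q mB) (coord 0%N)]_r g r).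
  by rewrite ge0_integral_pushforward.
transitivity (\int[mscale (NngNum QB0) (distribution P (X 0%N))]_r g r).
  apply: eq_measure_integral => C mC _.
  rewrite -[LHS]/(Q (coord 0%N @^-1` C `&` B)).
  rewrite -[RHS]/((fine (Q B))%:E * distribution P (X 0%N) C).
  by rewrite fineK ?fin_num_measure// muleC -coord_shift_indep// BE.
rewrite ge0_integral_mscale//= fineK ?fin_num_measure//.
by rewrite ge0_integral_distribution.
Qed.

Lemma integral_coord_invariant (g : R -> R) :
  measurable_fun setT g -> P.-integrable setT (EFin \o (g \o X 0%N)) ->
  \int[Q]_(w in B) (g (coord 0%N w))%:E = Q B * \int[P]_x (g (X 0%N x))%:E.
Proof.
move=> mg intg; have mg' : measurable_fun setT (EFin \o g).
  exact/measurable_EFinP.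
rewrite -[LHS]/(\int[Q]_(w in B) ((EFin \o g) \o coord 0%N) w).
rewrite -[X in Q B * X]/(\int[P]_x ((EFin \o g) \o X 0%N) x).
rewrite [LHS]integralE [X in Q B * X]integralE.
rewrite (funepos_comp (EFin \o g) (coord 0%N)).
rewrite (funeneg_comp (EFin \o g) (coord 0%N)).
rewrite (ge0_integral_coord_invariant (measurable_funepos mg') (funepos_ge0 _)).
rewrite (ge0_integral_coord_invariant (measurable_funeneg mg') (funeneg_ge0 _)).
rewrite (funepos_comp (EFin \o g) (X 0%N)) (funeneg_comp (EFin \o g) (X 0%N)).
have intg' := integrable_pos_fin_num measurableT intg.
rewrite (funepos_comp (EFin \o g) (X 0%N)) in intg'.
by rewrite [RHS]muleBr// ?fin_num_measure// fin_num_adde_defr.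
Qed.

End invariant_event.

(** A random walk with integrable steps of negative mean is almost surely
    bounded above.  On the invariant event that it is not, the maximal ergodic
    lemma makes the integral of the first step nonnegative; by independence
    this integral is the probability of the event times a negative mean, so
    the probability is 0.  This is the form in which the law of large numbers is used. *)
Lemma negative_drift_bounded (g : R -> R) :
  measurable_fun setT g -> P.-integrable setT (EFin \o (g \o X 0%N)) ->
  \int[P]_x (g (X 0%N x))%:E < 0 ->
  {ae P, forall x, exists K : R, forall n, (\sum_(i < n) g (X i x) <= K)%R}.
Proof.
move=> mg intg g_lt0.
have mf : measurable_fun setT (g \o coord 0%N : seqspace R -> R).
  exact: measurableT_comp.
pose B := unbounded_sums (@shift R) (g \o coord 0%N).
have mB : measurable B by exact: measurable_unbounded.
have BE : shift @^-1` B = B by exact: unbounded_invariant.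
have intf : (distribution P sample_path).-integrable setT
    (EFin \o (g \o coord 0%N)).
  apply: (@integrable_pushforward _ _ _ _ _ sample_path
    measurable_sample_path P setT (EFin \o (g \o coord 0%N))) => //.
  exact/measurable_EFinP.
have := maximal_ergodic (P := distribution P sample_path) (theta := @shift R)
  shift_preserves mf intf.
rewrite (integral_coord_invariant mB BE mg intg) => QB_ge0.
have QB0 : Q B = 0.
  apply/eqP/negPn/negP => QB_neq0; move: QB_ge0; apply/negP; rewrite -ltNge.
  by rewrite pmule_rlt0// lt0e QB_neq0 measure_ge0.
exists (sample_path @^-1` B); split => //.
  by rewrite -[X in measurable X]setTI; exact: measurable_sample_path.
move=> x /= unb; apply: contrapT => /existsNP[k hk]; apply: unb.
exists k%:R => n; have -> : (\sum_(i < n) g (X i x) =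
    \sum_(i < n) (g \o coord 0%N) (iter i shift (sample_path x)))%R.
  by apply: eq_bigr => i _; rewrite /= iter_shift.
rewrite (le_trans (sum_le_maxsum _ _ _ _))// leNgt; apply/negP => lt_k.
by apply: hk; exists n; exact: ltW.
Qed.

End iid.

(** * The radius of a weight with exponential bounds *)

Section radius.
Variable R : realType.

Lemma le_limn_einf (u v : (\bar R)^nat) :
  (\forall n \near \oo, (u n <= v n)%E) -> (limn_einf u <= limn_einf v)%E.
Proof.
move=> [N _ uv]; rewrite !limn_einf_lim; apply: lee_lim; [exact: is_cvg_einfs..|].
near=> n; apply: le_ereal_inf_tmp => _ [k /= nk <-].
apply: le_trans (uv k _); first by apply: ereal_inf_lbound; exists k.
rewrite /= (leq_trans _ nk)//; near: n; exact: nbhs_infty_ge.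
Unshelve. all: by end_near. Qed.

Lemma cvg_root_expR (K a : R) :
  (expR (K + a * n%:R) `^ n%:R^-1)%:E @[n --> \oo] --> (expR a)%:E.
Proof.
apply: cvg_EFin; first exact: nearW.
have cvgV : (n%:R^-1 : R) @[n --> \oo] --> 0.
  apply/gtr0_cvgV0; last exact: cvgr_idn.
  by near=> n; rewrite ltr0n; near: n; exact: nbhs_infty_gt.
have cvgE : (K * n%:R^-1 + a) @[n --> \oo] --> a.
  rewrite -[X in _ --> X]add0r -[X in _ --> X + _](mulr0 K).
  by apply: cvgD; [exact: cvgMr|exact: cvg_cst].
have : expR (K * n%:R^-1 + a) @[n --> \oo] --> expR a.
  by apply: continuous_cvg; [exact: continuous_expR|].
apply: cvg_trans; apply: near_eq_cvg; near=> n.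
rewrite /= -expRM mulrDl mulfK// pnatr_eq0 -lt0n.
near: n; exact: nbhs_infty_gt.
Unshelve. all: by end_near. Qed.

Lemma hardy_radius_le (w : nat -> R) (K a : R) :
  (forall n, 0 <= w n) -> (forall n, w n <= expR (K + a * n%:R)) ->
  (hardy_radius w <= (expR a)%:E)%E.
Proof.
move=> w0 wK; rewrite -(cvg_limn_einf_sup (@cvg_root_expR K a)).1.
apply: le_limn_einf; apply: nearW => n; rewrite lee_fin.
by rewrite ge0_ler_powR ?nnegrE ?invr_ge0 ?expR_ge0.
Qed.

Lemma hardy_radius_ge (w : nat -> R) (K a : R) :
  (forall n, expR (K + a * n%:R) <= w n) ->
  ((expR a)%:E <= hardy_radius w)%E.
Proof.
move=> wK; rewrite -(cvg_limn_einf_sup (@cvg_root_expR K a)).1.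
apply: le_limn_einf; apply: nearW => n; rewrite lee_fin.
by rewrite ge0_ler_powR ?nnegrE ?invr_ge0 ?expR_ge0// (le_trans _ (wK n))
  ?expR_ge0.
Qed.

Lemma hardy_radius_ge0 (w : nat -> R) : (0 <= hardy_radius w)%E.
Proof.
rewrite -(cvg_limn_einf_sup (cvg_cst (0 : \bar R))).1.
by apply: le_limn_einf; apply: nearW => n; rewrite lee_fin powR_ge0.
Qed.

End radius.

(** * Integrals of truncated logarithms *)

Section log_moments.
Context d (T : measurableType d) (R : realType) (P : probability T R).
Local Open Scope ereal_scope.

Lemma ae_bounded_integrable (Y : T -> R) (M : R) : measurable_fun setT Y ->
  {ae P, forall x, (`|Y x| <= M)%R} -> P.-integrable setT (EFin \o Y).
Proof.
move=> mY YM; apply/integrableP; split; first exact/measurable_EFinP.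
apply: (@le_lt_trans _ _ (\int[P]_x (cst `|M|%:E) x)).
  apply: ae_ge0_le_integral => //.
  - by apply: measurableT_comp => //; exact/measurable_EFinP.
  - by move=> x _; rewrite lee_fin.
  - by apply: filterS YM => x YxM _; rewrite lee_fin (le_trans YxM)// ler_norm.
by rewrite integral_cst// lte_mul_pinfty// ltey_eq fin_num_measure.
Qed.

Lemma measurable_lne : measurable_fun setT (fun r : R => lne r%:E).
Proof.
apply: measurable_fun_ifT => //.
  by apply: measurable_fun_ler => //; exact: measurable_cst.
apply/measurable_EFinP; exact: measurable_ln.
Qed.

(** Truncating at 1/(k+1) <= 1 leaves the positive part of the logarithm alone,
    and its negative part increases to that of [lne] (to +oo where Y <= 0), so
    monotone convergence applies to the negative part.  The limit may be -oo. *)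
Lemma cvg_integral_ln_max (Y : T -> R) : measurable_fun setT Y ->
  \int[P]_x (fun x => lne (Y x)%:E)^\+ x < +oo ->
  \int[P]_x (ln (Num.max (Y x) k.+1%:R^-1))%:E @[k --> \oo] -->
  \int[P]_x lne (Y x)%:E.
Proof.
move=> mY Yoo; pose h k x := (ln (Num.max (Y x) k.+1%:R^-1))%:E.
pose l x := lne (Y x)%:E.
have eps_gt0 k : (0 < k.+1%:R^-1 :> R)%R by rewrite invr_gt0 ltr0n.
have max_gt0 k x : (0 < Num.max (Y x) k.+1%:R^-1)%R.
  by rewrite lt_max eps_gt0 orbT.
have mh k : measurable_fun setT (h k).
  apply/measurable_EFinP/measurableT_comp => //; exact: measurable_maxr.
have ml : measurable_fun setT l.
  exact: (measurableT_comp measurable_lne).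
have hpos k : (h k)^\+ = l^\+.
  apply/funext => x; rewrite !funeposE /h /l.
  have [Y0|Y0] := ltP 0%R (Y x).
    rewrite lne_EFin//; have [//|Yk] := leP k.+1%:R^-1%R (Y x).
    have k1 : (k.+1%:R^-1 <= 1 :> R)%R by rewrite invf_le1 ?ler1n ?ltr0n.
    by rewrite !max_r// lee_fin ln_le0// (le_trans (ltW Yk)).
  rewrite le0_lneNy// max_r; last first.
    rewrite lee_fin ln_le0// ge_max (le_trans Y0)//=.
    by rewrite invf_le1 ?ler1n ?ltr0n.
  by rewrite max_r// leNye.
have h_nincr x : {homo h^~ x : m n / (m <= n)%N >-> n <= m}.
  move=> m n mn; rewrite lee_fin ler_ln ?posrE// ge_max !le_max lexx/=.
  by rewrite lef_pV2 ?posrE ?ltr0n// ler_nat ltnS mn orbT.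
have hneg_cvg x : (h k)^\- x @[k --> \oo] --> l^\- x.
  have [Y0|Y0] := ltP 0%R (Y x).
    apply: cvg_near_cst.
    have [k kY] : exists k, (k.+1%:R^-1 <= Y x)%R.
      exists (Num.truncn (Y x)^-1); rewrite -[leRHS]invrK.
      by rewrite lef_pV2 ?posrE ?ltr0n ?invr_gt0// ltW// truncnS_gt.
    exists k => // j /= kj.
    have Yj : (j.+1%:R^-1 <= Y x)%R.
      by rewrite (le_trans _ kY)// lef_pV2 ?posrE ?ltr0n// ler_nat.
    by rewrite !funenegE /h /l lne_EFin// (max_l Yj).
  rewrite funenegE /l le0_lneNy//= maxye; apply/cvgeyPge => A.
  exists (Num.truncn (expR A)) => // k /= Ak.
  have Yk : (Y x <= k.+1%:R^-1)%R by rewrite (le_trans Y0)// ltW.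
  rewrite funenegE le_max /h (max_r Yk) lnV ?posrE ?ltr0n// -EFinN opprK lee_fin.
  rewrite -[leLHS]expRK ler_ln ?posrE ?expR_gt0 ?ltr0n//.
  by rewrite (le_trans (ltW (truncnS_gt _)))// ler_nat.
have intE k : \int[P]_x h k x = \int[P]_x l^\+ x - \int[P]_x (h k)^\- x.
  by rewrite integralE hpos.
rewrite -[\int[P]_x lne _]/(\int[P]_x l x) integralE.
rewrite (_ : (fun k => _) = fun k => \int[P]_x l^\+ x - \int[P]_x (h k)^\- x);
  last by apply/funext => k; rewrite -intE.
apply: cvgeB => //.
- by rewrite fin_num_adde_defr// ge0_fin_numE// integral_ge0.
- exact: cvg_cst.
rewrite (_ : l^\- = fun x => limn (fun k => (h k)^\- x)); last first.
  by apply/funext => x; apply/esym/cvg_lim.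
apply: cvg_monotone_convergence => //.
- by move=> k; exact: measurable_funeneg.
- by move=> x _ m n mn; rewrite !funenegE le_max2// leeN2 h_nincr.
Qed.

End log_moments.

(** * Almost sure bounds on the radius *)

Section hardy.
Context d (T : measurableType d) (R : realType) (P : probability T R).
Variable X : nat -> {RV P >-> R}.
Hypothesis X_iid : iid X.
Hypothesis X_ge0 : forall n, nonneg_rv (X n).
Hypothesis X_bounded : bounded_rv (X 0%N).

Let measurable_lnX : measurable_fun setT (fun x => lne (X 0%N x)%:E).
Proof. exact: (measurableT_comp (@measurable_lne R)). Qed.

Lemma integral_lne_pos_lty :
  (\int[P]_x (fun x => lne (X 0%N x)%:E)^\+ x < +oo)%E.
Proof.
have [M XM] := X_bounded.
have max0 : 0 < Num.max M 1 by rewrite lt_max ltr01 orbT.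
apply: (@le_lt_trans _ _ (\int[P]_x (cst (ln (Num.max M 1))%:E x))%E); last first.
  by rewrite integral_cst// lte_mul_pinfty// ?ltey_eq ?fin_num_measure//
             lee_fin ln_ge0// le_max lexx orbT.
apply: ae_ge0_le_integral => //.
- exact: measurable_funepos.
- by move=> x _; rewrite lee_fin ln_ge0// le_max lexx orbT.
apply: filterS XM => x XxM _; rewrite funeposE ge_max.
rewrite [X in _ && X]lee_fin ln_ge0 ?andbT; last by rewrite le_max lexx orbT.
have [X0|X0] := leP (X 0%N x) 0; first by rewrite le0_lneNy ?lee_fin// leNye.
rewrite lne_EFin// lee_fin ler_ln ?posrE// le_max.
by rewrite (le_trans (ler_norm _) XxM).
Qed.

Lemma expected_ln_lty : (expected_ln (X 0%N) < +oo)%E.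
Proof.
rewrite /expected_ln integralE; apply: le_lt_trans integral_lne_pos_lty.
by rewrite geeDl// oppe_le0 integral_ge0.
Qed.

(** The variables may vanish and E(ln X_1) may be -oo, so ln X_1 is first
    truncated from below: this only increases w_n, makes the logarithm bounded,
    and keeps its mean below [a] once the truncation level is small.  The walk
    with steps ln (max X e) - a then has negative drift, and its boundedness
    says that w_n = O(e^(n a)). *)
Lemma hardy_radius_le_expR (a : R) : (expected_ln (X 0%N) < a%:E)%E ->
  {ae P, forall x,
    (hardy_radius (fun n => hardy_weight X n x) <= (expR a)%:E)%E}.
Proof.
move=> Ea.
have [k hk] : exists k,
    (\int[P]_x (ln (Num.max (X 0%N x) k.+1%:R^-1))%:E < a%:E)%E.
  have := cvg_integral_ln_max (measurable_funP (X 0%N)) integral_lne_pos_lty.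
  move=> /(_ _ (open_nbhs_nbhs (conj (@open_ereal_lt_ereal _ _) Ea))).
  by move=> [k _ /(_ k (leqnn k))]; exists k.
set e : R := k.+1%:R^-1 in hk.
have e0 : 0 < e by rewrite invr_gt0 ltr0n.
have maxe0 r : 0 < Num.max r e by rewrite lt_max e0 orbT.
pose l r := ln (Num.max r e); pose g r := l r - a.
have ml : measurable_fun setT l.
  by apply: measurableT_comp => //; exact: measurable_maxr.
have mg : measurable_fun setT g by apply: measurable_funB.
have intl : P.-integrable setT (EFin \o (l \o X 0%N)).
  have [M XM] := X_bounded.
  apply: (@ae_bounded_integrable _ _ _ _ _ (`|l M| + `|ln e|)).
    exact: measurableT_comp.
  apply: filterS XM => x XxM; rewrite /= ler_norml; apply/andP; split.
    rewrite (@le_trans _ _ (ln e))//; last first.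
      by rewrite ler_ln ?posrE// le_max lexx orbT.
    by rewrite lerNl (le_trans (ler_norm _))// normrN lerDr.
  rewrite (@le_trans _ _ (l M))//; last first.
    by rewrite (le_trans (ler_norm _))// lerDl.
  rewrite ler_ln ?posrE// ge_max !le_max lexx orbT andbT.
  by rewrite (le_trans (ler_norm _) XxM).
have inta : P.-integrable setT (EFin \o (cst a : T -> R)).
  exact: finite_measure_integrable_cst.
have intg : P.-integrable setT (EFin \o (g \o X 0%N)).
  exact: (integrableB measurableT intl inta).
have g_lt0 : (\int[P]_x (g (X 0%N x))%:E < 0)%E.
  rewrite /g integralB_EFin// (_ : \int[P]_x a%:E = a%:E)%E; last first.
    exact: etrans (integral_cst P measurableT a%:E)
      (etrans (congr1 (mule a%:E) (probability_setT P)) (mule1 _)).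
  by rewrite sube_lt0 ?hk ?orbT.
have Xge0 := ae_foralln X_ge0.
have := negative_drift_bounded X_iid mg intg g_lt0.
apply: filterS2 Xge0 => x X0 [K sumK].
apply: (@hardy_radius_le _ _ K).
  by move=> n; apply: prodr_ge0 => i _.
move=> n; apply: (@le_trans _ _ (\prod_(i < n) expR (l (X i x)))).
  apply: ler_prod => i _; rewrite X0 /= lnK ?posrE// le_max lexx //.
rewrite -expR_sum ler_expR -lerBlDr (le_trans _ (sumK n))//.
by rewrite sumrB sumr_const card_ord mulr_natr.
Qed.

(** When E(ln X_1) is finite the variables are almost surely positive and
    ln X_1 is integrable, so the steps a - ln X of the walk are used without
    truncation; boundedness says that e^(n a) = O(w_n). *)
Lemma expR_le_hardy_radius (a : R) :
  expected_ln (X 0%N) \is a fin_num -> (a%:E < expected_ln (X 0%N))%E ->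
  {ae P, forall x,
    ((expR a)%:E <= hardy_radius (fun n => hardy_weight X n x))%E}.
Proof.
move=> Efin aE.
pose L x := lne (X 0%N x)%:E.
have Lneg : (\int[P]_x L^\- x < +oo)%E.
  rewrite ltNge leye_eq; apply/negP => /eqP Loo; move: Efin.
  by rewrite /expected_ln integralE -/L Loo addeNy.
have intL : P.-integrable setT L.
  apply/integrableP; split => //.
  rewrite -[ltLHS]/(\int[P]_x (abse \o L) x)%E fune_abse ge0_integralD//.
  - by rewrite lte_add_pinfty// integral_lne_pos_lty.
  - exact: measurable_funepos.
  - exact: measurable_funeneg.
have X0_gt0 : {ae P, forall x, 0 < X 0%N x}.
  apply: filterS (integrable_ae measurableT intL) => x /(_ Logic.I) Lx.
  by rewrite ltNge; apply/negP => Xx; move: Lx; rewrite /L le0_lneNy ?lee_fin.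
have X_gt0 n : {ae P, forall x, 0 < X n x}.
  have [_ ident] := X_iid.
  have mN : measurable [set r : R | ~ 0 < r].
    rewrite (_ : mkset _ = `]-oo, 0%R]%classic); first exact: measurable_itv.
    by apply/seteqP; split=> r /=; rewrite in_itv/= leNgt => /negP.
  have mXN i : measurable (X i @^-1` [set r : R | ~ 0 < r]).
    by rewrite -[X in measurable X]setTI; exact: measurable_funP.
  exists (X n @^-1` [set r : R | ~ 0 < r]); split => //.
  rewrite -[LHS]/(distribution P (X n) [set r : R | ~ 0 < r]) (ident n 0%N)//.
  exact: ((@negligibleP _ _ _ P _ (mXN 0%N)).1 X0_gt0).
pose g r := a - ln r.
have mln : measurable_fun setT (@ln R \o X 0%N) by exact: measurableT_comp.
have mg : measurable_fun setT g.
  by apply: measurable_funB => //; exact: measurable_ln.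
have aeL : ae_eq P setT L (EFin \o (@ln R \o X 0%N)).
  by apply: filterS X0_gt0 => x Xx _; rewrite /L lne_EFin.
have intln : P.-integrable setT (EFin \o (@ln R \o X 0%N)).
  apply/integrableP; split; first exact/measurable_EFinP.
  have /integrableP[_] := intL; apply: le_lt_trans.
  rewrite le_eqVlt; apply/orP; left; apply/eqP/ae_eq_integral => //.
  - by apply: measurableT_comp => //; exact/measurable_EFinP.
  - exact: measurableT_comp.
  - by apply: ae_eq_sym; exact: ae_eq_comp.
have inta : P.-integrable setT (EFin \o (cst a : T -> R)).
  exact: finite_measure_integrable_cst.
have intg : P.-integrable setT (EFin \o (g \o X 0%N)).
  exact: (integrableB measurableT inta intln).
have g_lt0 : (\int[P]_x (g (X 0%N x))%:E < 0)%E.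
  rewrite /g integralB_EFin// (_ : \int[P]_x a%:E = a%:E)%E; last first.
    exact: etrans (integral_cst P measurableT a%:E)
      (etrans (congr1 (mule a%:E) (probability_setT P)) (mule1 _)).
  rewrite sube_lt0//; apply: (lt_le_trans aE).
  rewrite le_eqVlt; apply/orP; left; apply/eqP/ae_eq_integral => //.
  exact/measurable_EFinP.
have Xgt0 := ae_foralln X_gt0.
have := negative_drift_bounded X_iid mg intg g_lt0.
apply: filterS2 Xgt0 => x Xx [K sumK].
apply: (@hardy_radius_ge _ _ (- K)) => n.
rewrite (_ : hardy_weight X n x = expR (\sum_(i < n) ln (X i x))).
  rewrite ler_expR addrC lerBlDr -lerBlDl (le_trans _ (sumK n))//.
  by rewrite sumrB sumr_const card_ord mulr_natr.
by rewrite expR_sum; apply: eq_bigr => i _; rewrite lnK ?posrE.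
Qed.

End hardy.

(** * The convergence radius *)

Theorem lemma5p1 (d : measure_display) (T : measurableType d) (R : realType)
    (P : probability T R) (X : nat -> {RV P >-> R})
    (X_iid : iid X)
    (X_ge0 : forall n, nonneg_rv (X n))
    (X_bounded : forall n, bounded_rv (X n))
    (X_nondegenerate : nondegenerate_rv (X 0%N)) :
  \forall x \ae P,
    hardy_radius (fun n => hardy_weight X n x) = expeR (expected_ln (X 0%N)).
Proof.
have le_radius := hardy_radius_le_expR X_iid X_ge0 (X_bounded 0%N).
have ge_radius := expR_le_hardy_radius X_iid (X_bounded 0%N).
have := expected_ln_lty (X_bounded 0%N).
move: le_radius ge_radius; case: (expected_ln _) => [r| |] //
  le_radius ge_radius _.
- have up k : {ae P, forall x,
      (hardy_radius (fun n => hardy_weight X n x) <= (expR (r + harmonic k))%:E)%E}.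
    by apply: le_radius; rewrite lte_fin ltrDl invr_gt0 ltr0n.
  have lo k : {ae P, forall x,
      ((expR (r - harmonic k))%:E <= hardy_radius (fun n => hardy_weight X n x))%E}.
    by apply: ge_radius => //; rewrite lte_fin ltrBlDr ltrDl invr_gt0 ltr0n.
  (* Countably many values of a, so that one null set serves for all. *)
  have {}up := ae_foralln up; have {}lo := ae_foralln lo.
  apply: filterS2 up lo => x up lo; rewrite -[expeR _]/((expR r)%:E).
  apply/eqP; rewrite eq_le; apply/andP; split.
  + have cvg_up : (expR (r + harmonic k))%:E @[k --> \oo] --> (expR r)%:E.
      apply: cvg_EFin; first exact: nearW.
      apply: continuous_cvg; first exact: continuous_expR.
      rewrite -[X in _ --> X]addr0.
      by apply: cvgD; [exact: cvg_cst|exact: cvg_harmonic].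
    rewrite -(cvg_lim _ cvg_up)//; apply: lime_ge; last exact: nearW.
    by apply/cvg_ex; eexists; exact: cvg_up.
  + have cvg_lo : (expR (r - harmonic k))%:E @[k --> \oo] --> (expR r)%:E.
      apply: cvg_EFin; first exact: nearW.
      apply: continuous_cvg; first exact: continuous_expR.
      rewrite -[X in _ --> X]subr0.
      by apply: cvgB; [exact: cvg_cst|exact: cvg_harmonic].
    rewrite -(cvg_lim _ cvg_lo)//; apply: lime_le; last exact: nearW.
    by apply/cvg_ex; eexists; exact: cvg_lo.
- have up k := le_radius (- k%:R) (ltNyr _).
  have {}up := ae_foralln up.
  apply: filterS up => x up; rewrite -[expeR _]/0%E.
  apply/eqP; rewrite eq_le hardy_radius_ge0 andbT.
  have cvg_up : (expR (- k%:R))%:E @[k --> \oo] --> (0 : \bar R).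
    by apply: cvg_EFin; [exact: nearW|exact: cvgn_expR].
  rewrite -(cvg_lim _ cvg_up)//; apply: lime_ge; last exact: nearW.
  by apply/cvg_ex; eexists; exact: cvg_up.
Qed.
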